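(* Let $\mathcal{P}$ be a random walk program that is positively almost surely terminating, let $\lambda_1,\dots,\lambda_c$ be the pairwise distinct complex roots of its characteristic polynomial $\chi_{\mathcal{P}}(\lambda)=\sum_{-k\le j\le m}p_j\lambda^{k+j}-\lambda^k$ with multiplicities $v_1,\dots,v_c$, and let $C(x)=\frac1{p'}$ if $p'>0$ and $C(x)=-\frac{1}{\mu_{\mathcal{P}}}\cdot x$ if $p'=0$, where $\mu_{\mathcal{P}}=\sum_{-k\le j\le m}j\,p_j$. Then the expected runtime of $\mathcal{P}$ is $rt^{\mathcal{P}}_x=0$ for $x\le0$ and $$rt^{\mathcal{P}}_x=C(x)+\sum_{1\le j\le c,\ |\lambda_j|\le1}\ \sum_{0\le u\le v_j-1}a_{j,u}\,\lambda_j^x\,x^u\quad\text{for }x>0,$$ where the coefficients $a_{j,u}$ are the unique solution of the $k$ linear equations $$0=C(x)+\sum_{1\le j\le c,\ |\lambda_j|\le1}\ \sum_{0\le u\le v_j-1}a_{j,u}\,\lambda_j^x\,x^u\quad\text{for }-k+1\le x\le0.$$ In particular, if $k=0$, then $rt^{\mathcal{P}}_x=\frac{1}{p'}$ for $x>0$.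
   Context: A random walk program is a one-variable program: while $(x>0)$ do: $x:=x+j$ with probability $p_j$ for each $-k\le j\le m$; $x:=d$ with probability $p'$; where $m,k\in\mathbb{N}$, $d\in\mathbb{Z}$, $d\le0$, the $p_j,p'\ge0$ are constants summing to 1, and $m>0$ implies $p_m>0$, $k>0$ implies $p_{-k}>0$. Semantics: Markov chain on $\mathbb{Z}$ started at $x$ moving from $z>0$ to $z+j$ w.p. $p_j$ and to $d$ w.p. $p'$, and staying put at $z\le0$; $T$ is the first index of a run with value $\le0$; the expected runtime $rt^{\mathcal{P}}_x$ is $\mathbb{E}_x(T)$ if $\mathbb{P}_x(T<\infty)=1$ and $\infty$ otherwise; positively almost surely terminating means $rt^{\mathcal{P}}_x<\infty$ for every $x\in\mathbb{Z}$. *)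

(* Defs.v *)
From HB Require Import structures.
From mathcomp Require Import all_boot all_order all_algebra.
From mathcomp Require Import complex.
From mathcomp Require Import all_classical all_reals all_analysis.
From mathcomp Require Import measurable_realfun ring lra.

Set Implicit Arguments.
Unset Strict Implicit.
Unset Printing Implicit Defensive.

Import Order.TTheory GRing.Theory Num.Theory.
Import numFieldNormedType.Exports.

Local Open Scope classical_set_scope.
Local Open Scope ring_scope.
Local Open Scope complex_scope.

(* Only the values [rw_p P j] for [- rw_k <= j <= rw_m] are meaningful; the
   index [i < (rw_k + rw_m).+1] of the sums below stands for [j = i - rw_k]. *)
Record rw_program (R : realType) := RwProgram {
  rw_m : nat;
  rw_k : nat;
  rw_d : int;
  rw_p : int -> R;
  rw_p' : R;
  rw_d_le0 : rw_d <= 0;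
  rw_p_ge0 : forall j : int, - rw_k%:Z <= j <= rw_m%:Z -> 0 <= rw_p j;
  rw_p'_ge0 : 0 <= rw_p';
  rw_sum1 : \sum_(i < (rw_k + rw_m).+1) rw_p (i%:Z - rw_k%:Z) + rw_p' = 1;
  rw_pm_gt0 : (0 < rw_m)%N -> 0 < rw_p rw_m%:Z;
  rw_pk_gt0 : (0 < rw_k)%N -> 0 < rw_p (- rw_k%:Z)
}.

HB.instance Definition _ := isPointed.Build int 0.

Definition cylinder (n : nat) (s : nat -> int) : set (nat -> int) :=
  [set w | forall i, (i <= n)%N -> w i = s i].

Definition cylinders : set (set (nat -> int)) :=
  [set C | exists n s, C = cylinder n s].

Definition run := g_sigma_algebraType cylinders.

Section semantics.
Context {R : realType} (P : rw_program R).

Definition rw_trans (z z' : int) : R :=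
  if 0 < z then
    \sum_(i < (rw_k P + rw_m P).+1)
       (if z' == z + (i%:Z - (rw_k P)%:Z) then rw_p P (i%:Z - (rw_k P)%:Z) else 0)
    + (if z' == rw_d P then rw_p' P else 0)
  else if z' == z then 1 else 0.

Definition is_run_measure (x : int) (Q : probability run R) : Prop :=
  forall (n : nat) (s : nat -> int),
    Q (cylinder n s) =
    (if s 0%N == x then \prod_(i < n) rw_trans (s i) (s i.+1) else 0)%:E.

End semantics.

(* Existence of the run measure: a point [v] of [0, 1[ with Lebesgue measure is
   decoded into a run by repeatedly splitting the unit interval into pieces
   whose lengths are the probabilities of the branches of the program. *)
Lemma lebesgue_measure_affine (R : realType) (c q : R) (A : set R) :
  0 < q -> measurable A ->
  lebesgue_measure ((fun v => (v - c) / q) @^-1` A) =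
    (q%:E * lebesgue_measure A)%E.
Proof.
move=> q0 mA.
pose f : measurableTypeR R -> measurableTypeR R := fun v => (v - c) / q.
have mf : measurable_fun [set: measurableTypeR R] f.
  by apply: measurable_funM => //; exact: measurable_funB.
have q10 : 0 <= q^-1 by rewrite invr_ge0 ltW.
pose nu : {measure set (measurableTypeR R) -> \bar R} :=
  mscale (NngNum q10) (measure_function_pushforward__canonical__measure_function_Measure
    lebesgue_measure mf).
rewrite (@lebesgue_measure_unique R nu _ A mA).
  by rewrite /nu /= /mscale /= /pushforward muleA -EFinM mulfV ?mul1e// gt_eqF.
move=> _ [[a b] _ <-] /=.
rewrite /nu /= /mscale /= /pushforward.
rewrite (_ : _ @^-1` _ = `]c + q * a, c + q * b]%classic); last first.
  apply/seteqP; split => v /=;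
    rewrite !in_itv/= /f ltr_pdivlMr// ler_pdivrMr// => /andP[h1 h2];
    apply/andP; split; lra.
rewrite !lebesgue_measure_itv/= !lte_fin ltrD2l ltr_pM2l//.
case: ifP => _; last by rewrite mule0.
by rewrite -!EFinD -EFinM; congr (_%:E); field; rewrite gt_eqF.
Qed.

Section run_measure_existence.
Context {R : realType} (P : rw_program R).
Local Notation mu := (@lebesgue_measure R).
Local Notation N := (rw_k P + rw_m P).+2.

Let weight (i : nat) : R :=
  if (i < (rw_k P + rw_m P).+1)%N then rw_p P (i%:Z - (rw_k P)%:Z) else rw_p' P.

Let target (z : int) (i : nat) : int :=
  if 0 < z then
    (if (i < (rw_k P + rw_m P).+1)%N then z + (i%:Z - (rw_k P)%:Z) else rw_d P)
  else z.

Let cumul (n : nat) : R := \sum_(i < n) weight i.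

Let branch (v : R) : nat := find (fun i => v < cumul i.+1) (iota 0 N).

Let decode1 (zv : int * R) : int * R :=
  let i := branch zv.2 in (target zv.1 i, (zv.2 - cumul i) / weight i).

Let decode (z : int) (v : R) (n : nat) : int := (iter n decode1 (z, v)).1.

Let weight_ge0 i : (i < N)%N -> 0 <= weight i.
Proof.
move=> _; rewrite /weight; case: ltnP => [iN|_]; last exact: rw_p'_ge0.
apply: rw_p_ge0; move: iN => /=; rewrite ltnS => iN.
by rewrite lerBrDr addNr lez_nat leq0n /= lerBlDr -PoszD lez_nat addnC.
Qed.

Let cumulS n : cumul n.+1 = cumul n + weight n.
Proof. by rewrite /cumul big_ord_recr. Qed.

Let cumul_le i j : (i <= j)%N -> (j <= N)%N -> cumul i <= cumul j.
Proof.
move=> ij jN; rewrite -(subnKC ij) in jN *.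
elim: (j - i)%N jN => [|n IHn] jN; first by rewrite addn0.
rewrite addnS in jN *.
by rewrite cumulS (le_trans (IHn (ltnW jN)))// lerDl weight_ge0.
Qed.

Let cumulN : cumul N = 1.
Proof.
rewrite cumulS -[RHS](rw_sum1 P) /cumul /weight ltnn; congr (_ + _).
by apply: eq_bigr => i _; rewrite ltn_ord.
Qed.

Let trans_target z z' :
  rw_trans P z z' = \sum_(i < N | target z i == z') weight i.
Proof.
rewrite big_mkcond /rw_trans /target; case: ifPn => _.
  rewrite [RHS]big_ord_recr /= /weight !ltnn; congr (_ + _).
    apply: eq_bigr => i _; by rewrite ltn_ord eq_sym.
  by rewrite eq_sym.
have [_|_] := eqVneq z z'; first by rewrite -[LHS]cumulN.
by rewrite big1.
Qed.

Let branchP (v : R) i : 0 <= v < 1 -> (i < N)%N ->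
  reflect (branch v = i) (cumul i <= v < cumul i.+1).
Proof.
move=> /andP[v0 v1] iN.
have hasb : has (fun i => v < cumul i.+1) (iota 0 N).
  by apply/hasP; exists N.-1; rewrite ?mem_iota ?leq0n//= ?add0n// cumulN.
have bN : (branch v < N)%N by move: hasb; rewrite has_find size_iota.
have h1 : v < cumul (branch v).+1.
  by have := nth_find 0%N hasb; rewrite nth_iota// add0n.
have h2 : cumul (branch v) <= v.
  case E : (branch v) => [|b]; first by rewrite /cumul big_ord0.
  have bb : (b < branch v)%N by rewrite E.
  have := before_find 0%N bb.
  rewrite nth_iota ?add0n; last by rewrite (ltn_trans _ bN) // E.
  by move/negbT; rewrite -leNgt.
apply: (iffP idP) => [/andP[h3 h4]|<-]; last by rewrite h1 h2.
apply/eqP; rewrite eqn_leq; apply/andP; split; rewrite leqNgt; apply/negP => h.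
- have := cumul_le h (ltnW bN); lra.
- have := cumul_le h (ltnW iN); lra.
Qed.

Let code (n : nat) (s : nat -> int) : set R :=
  [set v | 0 <= v < 1 /\ cylinder n s (decode (s 0%N) v)].

Let piece (n : nat) (s : nat -> int) (i : nat) : set R :=
  `[cumul i, cumul i.+1[ `&`
  ((fun v => (v - cumul i) / weight i) @^-1` code n (fun j => s j.+1)).

Let codeS n s :
  code n.+1 s = \big[setU/set0]_(i < N | target (s 0%N) i == s 1%N) piece n s i.
Proof.
have decodeS z v i : decode z v i.+1 =
    decode (target z (branch v)) ((v - cumul (branch v)) / weight (branch v)) i.
  by rewrite /decode iterSr.
rewrite -bigcup_seq_cond; apply/seteqP; split => v.
- move=> [v01 vs].
  have hasb : exists2 i, (i < N)%N & cumul i <= v < cumul i.+1.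
    have bN : (branch v < N)%N.
      rewrite /branch -[X in (_ < X)%N](size_iota 0 N) -has_find.
      apply/hasP; exists N.-1; rewrite ?mem_iota ?leq0n//= ?add0n// cumulN.
      by case/andP: v01.
    by exists (branch v) => //; exact/(branchP v01 bN).
  have [i iN hi] := hasb; have /branchP bi := hi.
  have {}bi := bi v01 iN.
  exists (Ordinal iN) => /=.
    rewrite mem_index_enum /=; apply/eqP.
    by have := vs 1%N isT; rewrite decodeS bi.
  split; first by rewrite /= in_itv.
  have ts : target (s 0%N) i = s 1%N by have := vs 1%N isT; rewrite decodeS bi.
  have wi : 0 < weight i by have := cumulS i; lra.
  split.
    by rewrite ler_pdivlMr// ltr_pdivrMr// mul0r mul1r; have := cumulS i; lra.
  by move=> j jn; have := vs j.+1 jn; rewrite decodeS bi ts.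
- move=> [[i iN] /= /andP[_ /eqP ts]] [/=]; rewrite in_itv/= => hi [_ vs].
  have v01 : 0 <= v < 1.
    have := cumul_le (leq0n i) (ltnW iN); rewrite {1}/cumul big_ord0.
    have := cumul_le iN (leqnn N); rewrite cumulN; lra.
  have /(branchP v01 iN) bi := hi.
  split => // -[|j] jn; first by [].
  by rewrite decodeS bi ts; exact: vs.
Qed.

Let measure_code n s :
  measurable (code n s) /\
  mu (code n s) = (\prod_(i < n) rw_trans P (s i) (s i.+1))%:E.
Proof.
elim: n s => [|n IHn] s.
  have -> : code 0 s = `[0, 1[%classic.
    apply/seteqP; split => v /=; rewrite in_itv/=; first by case.
    by move=> v01; split => // i; rewrite leqn0 => /eqP ->.
  split; first exact: measurable_itv.
  by rewrite lebesgue_measure_itv/= lte_fin ltr01 big_ord0 -EFinD subr0.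
have [mC muC] := IHn (fun j => s j.+1).
have mP (i : 'I_N) : measurable (piece n s i).
  apply: measurableI; first exact: measurable_itv.
  rewrite -[X in measurable X]setTI.
  have : measurable_fun [set: R] (fun v : R => (v - cumul i) / weight i).
    by apply: measurable_funM => //; exact: measurable_funB.
  by move=> mf; apply: mf.
have muP (i : 'I_N) : mu (piece n s i) =
    (weight i * \prod_(i < n) rw_trans P (s i.+1) (s i.+2))%:E.
  have := weight_ge0 (ltn_ord i); rewrite le_eqVlt => /predU1P[w0|w0].
    rewrite /piece cumulS -w0 addr0 mul0r set_itvco0 set0I measure0//.
  rewrite EFinM -muC -(@lebesgue_measure_affine R (cumul i)) //.
  congr mu; apply/setIidr => v [] /=.
  rewrite ler_pdivlMr// ltr_pdivrMr// mul0r mul1r in_itv/= cumulS => ? _.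
  by lra.
have tP : trivIset setT (fun i : 'I_N => piece n s i).
  apply/trivIsetP => i j _ _ ij; rewrite /piece.
  apply/seteqP; split => // v [[vi _] [vj _]].
  move: vi vj; rewrite /= !in_itv /= => vi vj.
  have v01 : 0 <= v < 1.
    have := cumul_le (leq0n i) (ltnW (ltn_ord i)); rewrite {1}/cumul big_ord0.
    have := cumul_le (ltn_ord i) (leqnn N); rewrite cumulN; lra.
  move: vi vj => /(branchP v01 (ltn_ord i)) bi /(branchP v01 (ltn_ord j)) bj.
  by move/eqP: ij; apply; apply/val_inj; rewrite /= -bi -bj.
rewrite codeS; split; first exact: bigsetU_measurable.
rewrite measure_bigsetU_ord// (eq_bigr _ (fun i _ => muP i)) sumEFin.
by rewrite -mulr_suml -trans_target big_ord_recl.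
Qed.

Lemma exists_run_measure (x : int) :
  exists Q : probability run R, is_run_measure P x Q.
Proof.
pose I01 : set R := `[0, 1[%classic.
have mI : measurable I01 by exact: measurable_itv.
pose f (v : measurableTypeR R) : run := decode x (if 0 <= v < 1 then v else 0).
have preim n s : I01 `&` f @^-1` cylinder n s =
    if s 0%N == x then code n s else set0.
  case: ifPn => [/eqP sx|sx]; apply/seteqP; split => v //=.
  - by rewrite /I01 /= in_itv/= => -[v01]; rewrite /f v01 -sx.
  - by case=> v01 vs; rewrite /I01 /= in_itv/= v01; split=> //; rewrite /f v01 -sx.
  - by move=> [_ /(_ 0%N isT)] e; move: sx; rewrite -e eqxx.
have mf : measurable_fun [set: measurableTypeR R] f.
  apply: (@measurability _ _ (measurableTypeR R) run setT f cylinders) => //.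
  move=> _ [_ [n [s ->]] <-]; rewrite setTI.
  rewrite -[X in measurable X](setUIDK _ I01).
  rewrite setIC preim; apply: measurableU.
    by case: ifP => // _; exact: (measure_code n s).1.
  have [s0|s0] := pselect (cylinder n s (decode x 0)).
    rewrite (_ : _ `\` _ = ~` I01); first exact: measurableC.
    apply/seteqP; split => v /=; first by case.
    rewrite /I01 /= in_itv/= => /negP/negbTE v01; split; first by rewrite /f v01.
    by rewrite v01.
  rewrite (_ : _ `\` _ = set0) //.
  apply/seteqP; split => v //= -[]; rewrite /I01 /= in_itv/=.
  by rewrite /f; case: ifP.
pose Q0 : {measure set run -> \bar R} :=
  measure_function_pushforward__canonical__measure_function_Measure
    (mrestr lebesgue_measure mI) mf.
have Q0E n s : Q0 (cylinder n s) =
    (if s 0%N == x then \prod_(i < n) rw_trans P (s i) (s i.+1) else 0)%:E.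
  rewrite /Q0 /= /pushforward /mrestr setIC preim.
  by case: ifP => _; rewrite ?measure0// (measure_code n s).2.
have Q0T : Q0 setT = 1%E.
  rewrite /Q0 /= /pushforward /mrestr preimage_setT setTI.
  by rewrite lebesgue_measure_itv/= lte_fin ltr01 -EFinD subr0.
exists (mnormalize Q0 point) => n s /=.
by rewrite /mnormalize Q0T onee_eq0 /= invr1 mule1 Q0E.
Qed.

End run_measure_existence.

Section expected_runtime.
Context {R : realType} (P : rw_program R).

(* The run measure is determined by its values on cylinders, which form (with
   the empty set) a pi-system generating the sigma-algebra of [run]. *)
Definition run_measure (x : int) : probability run R :=
  sval (cid (exists_run_measure P x)).

Lemma run_measureP (x : int) : is_run_measure P x (run_measure x).
Proof. exact: svalP (cid (exists_run_measure P x)). Qed.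

(* [ereal_inf set0 = +oo], for the runs that never terminate. *)
Definition termination_time (w : run) : \bar R :=
  ereal_inf [set n%:R%:E | n in [set n | w n <= 0]].

Definition expected_runtime (x : int) : \bar R :=
  if run_measure x [set w | (termination_time w < +oo)%E] == 1%E
  then (\int[run_measure x]_w termination_time w)%E
  else +oo%E.

Definition positively_ast : Prop :=
  forall x : int, (expected_runtime x < +oo)%E.

End expected_runtime.

Section closed_form.
Context {R : realType} (P : rw_program R).

Definition rw_charpoly : {poly R[i]} :=
  \sum_(i < (rw_k P + rw_m P).+1) (rw_p P (i%:Z - (rw_k P)%:Z))%:C *: 'X^i
  - 'X^(rw_k P).

Definition rw_drift : R :=
  \sum_(i < (rw_k P + rw_m P).+1)
     (i%:Z - (rw_k P)%:Z)%:~R * rw_p P (i%:Z - (rw_k P)%:Z).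

(* When [rw_p' P = 0] and the program is positively almost surely terminating,
   [rw_drift P] is negative, so no division by zero occurs. *)
Definition rw_C (x : int) : R :=
  if 0 < rw_p' P then 1 / rw_p' P else - (1 / rw_drift) * x%:~R.

Definition rw_ansatz (c : nat) (lam : 'I_c -> R[i]) (v : 'I_c -> nat)
    (a : 'I_c -> nat -> R[i]) (x : int) : R[i] :=
  (rw_C x)%:C +
  \sum_(j < c | `|lam j| <= 1)
    \sum_(u < v j) a j u * lam j ^ x * x%:~R ^+ u.

End closed_form.

(* Main.v *)
Require Import Defs.
From mathcomp Require Import all_boot all_order all_algebra.
From mathcomp Require Import complex.
From mathcomp Require Import all_classical all_reals all_analysis.
From mathcomp Require Import measurable_realfun ring lra zify.

Set Implicit Arguments.
Unset Strict Implicit.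
Unset Printing Implicit Defensive.

Import Order.TTheory GRing.Theory Num.Theory.

Local Open Scope ring_scope.
Local Open Scope complex_scope.

(* The expected runtime is the sum over [n] of the probabilities of being alive
   at time [n], hence a solution of the recurrence obtained by conditioning on
   the first step, and its difference [g] to the particular solution [C] solves
   the homogeneous recurrence with characteristic polynomial chi. As [g] grows
   at most linearly, the factors of chi with roots outside the closed unit disk
   can be cancelled, so [g] is a combination of the [lam_j ^ x * x ^ u] with
   [|lam_j| <= 1]. Such combinations are bounded on the positive integers, since
   the roots on the unit circle are simple; by almost sure termination, one that
   vanishes for [-k < x <= 0] vanishes identically, which gives uniqueness by
   linear independence. *)

(** * Polynomials in the shift operator and their kernels on half lines of integers *)

Section linear_recurrences.
Context {C : numFieldType}.
Implicit Types (p q r : {poly C}) (f g : int -> C) (y z : C) (s : seq C).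

(** The operator [p(E)] for the shift [(E f) x = f (x + 1)]. Below, [sdiff z] is [E - z], and
    [sdiffs s] composes these factors over [s], the head acting first. *)
Definition shift_act p f (x : int) : C := \sum_(i < size p) p`_i * f (x + i%:Z).

Definition sdiff z f (x : int) : C := f (x + 1) - z * f x.

Definition sdiffs s f : int -> C := foldl (fun g z => sdiff z g) f s.

Lemma shift_act_widen n p f x : (size p <= n)%N ->
  shift_act p f x = \sum_(i < n) p`_i * f (x + i%:Z).
Proof.
move=> pn; rewrite /shift_act (big_ord_widen n (fun i => p`_i * f (x + i%:Z)) pn).
rewrite big_mkcond; apply: eq_bigr => i _.
by case: ltnP => // pi; rewrite nth_default// mul0r.
Qed.

Lemma shift_actZ a p f x : shift_act (a *: p) f x = a * shift_act p f x.
Proof.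
rewrite (@shift_act_widen (size p)) ?size_scale_leq// mulr_sumr.
by apply: eq_bigr => i _; rewrite coefZ mulrA.
Qed.

Lemma shift_act_XsubCM z p f x :
  shift_act (('X - z%:P) * p) f x = shift_act p (sdiff z f) x.
Proof.
rewrite (@shift_act_widen (size p).+1); last first.
  have [->|p0] := eqVneq p 0; first by rewrite mulr0 size_poly0.
  by rewrite (leq_trans (size_polyMleq _ _))// size_XsubC.
under eq_bigr => i _ do rewrite mulrBl coefB coefXM coefCM mulrBl.
rewrite sumrB big_ord_recl /= mul0r add0r big_ord_recr /=.
rewrite nth_default// mulr0 mul0r addr0 -sumrB.
apply: eq_bigr => i _; rewrite /sdiff mulrBr.
have -> : x + (bump 0 i)%:Z = x + i%:Z + 1 by rewrite /bump /=; lia.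
by ring.
Qed.

Lemma shift_act_prod_XsubC s f x :
  shift_act (\prod_(z <- s) ('X - z%:P)) f x = sdiffs s f x.
Proof.
elim: s f => [|z s IHs] f.
  by rewrite big_nil /shift_act size_poly1 big_ord1 coef1 mul1r addr0.
by rewrite big_cons shift_act_XsubCM IHs.
Qed.

Lemma sdiff_eq0 z f (x0 : int) : z != 0 ->
  (forall x, x0 <= x -> sdiff z f x = 0) ->
  forall x, x0 <= x -> f x = f x0 / z ^ x0 * z ^ x.
Proof.
move=> z0 fz x xx; have -> : x = x0 + `|x - x0|%N%:Z by lia.
elim: (`|x - x0|%N) => [|n IHn].
  by rewrite addr0 divfK// expfz_neq0.
have /eqP := fz (x0 + n%:Z) ltac:(lia); rewrite subr_eq0 => /eqP.
rewrite IHn; have -> : x0 + n.+1%:Z = x0 + n%:Z + 1 by lia.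
by move=> ->; rewrite (expfzDr _ 1) // expr1z; ring.
Qed.

(** What [E - z] does to the polynomial factor of [y ^ x * q x]. *)
Definition exp_sdiff z y q : {poly C} := y *: (q \Po ('X + 1%:P)) - z *: q.

Lemma sdiff_exp z y q x : y != 0 ->
  sdiff z (fun t => y ^ t * q.[t%:~R]) x = y ^ x * (exp_sdiff z y q).[x%:~R].
Proof.
move=> y0; rewrite /sdiff /exp_sdiff hornerD hornerN !hornerZ horner_comp.
rewrite hornerD hornerX hornerC expfzDr// expr1z.
by rewrite (_ : (x + 1)%:~R = x%:~R + 1 :> C) ?intrD//; ring.
Qed.

Lemma size_Xadd1 : size ('X + 1%:P : {poly C}) = 2.
Proof. by rewrite size_polyDl ?size_polyX// size_polyC oner_eq0. Qed.

Lemma coef_Xadd1_exp i n : ((('X : {poly C}) + 1%:P) ^+ i)`_n = 'C(i, n)%:R.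
Proof.
rewrite exprD1n coef_sum.
under eq_bigr => j _ do rewrite coefMn coefXn.
case: (ltnP n i.+1) => ni.
  rewrite (bigD1 (Ordinal ni)) //= eqxx big1 ?addr0// => j.
  by rewrite -val_eqE /= eq_sym => /negbTE ->; rewrite mul0rn.
rewrite bin_small// big1// => j _.
by rewrite gtn_eqF ?mul0rn// (leq_trans (ltn_ord j)).
Qed.

Lemma coef_comp_Xadd1 q n : (size q <= n.+1)%N -> (q \Po ('X + 1%:P))`_n = q`_n.
Proof.
move=> qn; rewrite coef_comp_poly.
under eq_bigr => i _ do rewrite coef_Xadd1_exp.
case: (ltnP n (size q)) => nq.
  rewrite (bigD1 (Ordinal nq)) //= binn mulr1 big1 ?addr0// => j.
  rewrite -val_eqE /= => jn; rewrite bin_small ?mulr0//.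
  by rewrite ltn_neqAle jn -ltnS (leq_trans (ltn_ord j)).
rewrite nth_default// big1// => j _.
by rewrite bin_small ?mulr0// (leq_trans (ltn_ord j)).
Qed.

Lemma size_exp_sdiff z y q : (size (exp_sdiff z y q) <= size q)%N.
Proof.
rewrite (leq_trans (size_polyD _ _))// size_polyN geq_max size_scale_leq andbT.
by rewrite (leq_trans (size_scale_leq _ _))// size_comp_poly2 ?size_Xadd1.
Qed.

(** Translating [q] by 1 leaves its top coefficient alone, and [n] lies at or above the top degree.
    Hence the size drops for [y = z] and is kept for [y != z]. *)
Lemma coef_exp_sdiff z y q n : (size q <= n.+1)%N ->
  (exp_sdiff z y q)`_n = (y - z) * q`_n.
Proof. by move=> qn; rewrite coefB !coefZ coef_comp_Xadd1// mulrBl. Qed.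

Lemma size_exp_sdiff_eq z q : (size (exp_sdiff z z q) <= (size q).-1)%N.
Proof.
apply/leq_sizeP => n qn; rewrite coef_exp_sdiff ?subrr ?mul0r//.
by lia.
Qed.

Lemma size_exp_sdiff_neq z y q : y != z -> size (exp_sdiff z y q) = size q.
Proof.
move=> yz; apply/eqP; rewrite eqn_leq size_exp_sdiff /=.
have [->|q0] := eqVneq q 0; first by rewrite size_poly0.
rewrite leqNgt; apply/negP => lt; have := coef_exp_sdiff z y (leqSpred (size q)).
rewrite nth_default; last by move: lt; case: (size q).
by move/esym/eqP; rewrite mulf_eq0 subr_eq0 (negbTE yz)/= -lead_coefE lead_coef_eq0 (negbTE q0).
Qed.

Lemma exp_sdiffD z y q r : exp_sdiff z y (q + r) = exp_sdiff z y q + exp_sdiff z y r.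
Proof. by rewrite /exp_sdiff comp_polyD !scalerDr opprD addrACA. Qed.

Lemma exp_sdiffZ z y a q : exp_sdiff z y (a *: q) = a *: exp_sdiff z y q.
Proof. by rewrite /exp_sdiff comp_polyZ scalerBr !scalerA mulrC (mulrC z). Qed.

(** Induction on [d]: a multiple of the image of a monomial cancels the coefficient of degree [d] in
    [r]. In the resonant case [y = z] the operator lowers degrees, so [q] is allowed one more. *)
Lemma exp_sdiff_onto z y r d : y != 0 -> (size r <= d)%N ->
  exists2 q : {poly C}, (size q <= d + (y == z))%N & exp_sdiff z y q = r.
Proof.
move=> y0; elim: d r => [|d IHd] r rd.
  exists 0; first by rewrite size_poly0.
  rewrite /exp_sdiff comp_poly0 !scaler0 subr0.
  by apply/esym/eqP; rewrite -size_poly_eq0 -leqn0.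
pose M : {poly C} := 'X^(d + (y == z)).
have sM : (size (exp_sdiff z y M) <= d.+1)%N.
  rewrite /M; have [<-|_] := eqVneq y z; last first.
    by rewrite (leq_trans (size_exp_sdiff _ _ _))// size_polyXn addn0.
  by rewrite (leq_trans (size_exp_sdiff_eq _ _))// size_polyXn addn1.
(* The coefficient is [y - z], or [(d + 1) * y] in the resonant case. *)
have cM : (exp_sdiff z y M)`_d != 0.
  rewrite /M; have [<-|yz] := eqVneq y z; last first.
    rewrite addn0 coef_exp_sdiff ?size_polyXn// coefXn eqxx mulr1 subr_eq0 //.
  rewrite addn1 coefB !coefZ coefXn eqn_leq ltnn andbF mulr0 subr0.
  by rewrite mulf_neq0// comp_Xn_poly coef_Xadd1_exp binSn pnatr_eq0.
have [|q qd Lq] := IHd (r - (r`_d / (exp_sdiff z y M)`_d) *: exp_sdiff z y M).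
  apply/leq_sizeP => n; rewrite leq_eqVlt => /predU1P[<-|dn].
    by rewrite coefB coefZ divfK// subrr.
  rewrite coefB coefZ (nth_default _ (leq_trans sM dn)).
  by rewrite (nth_default _ (leq_trans rd dn)) mulr0 subrr.
exists (q + (r`_d / (exp_sdiff z y M)`_d) *: M).
  rewrite (leq_trans (size_polyD _ _))// geq_max (leq_trans qd)/=; last by lia.
  by rewrite (leq_trans (size_scale_leq _ _))// size_polyXn.
by rewrite exp_sdiffD exp_sdiffZ Lq subrK.
Qed.

(** * Exponential polynomials with distinct nonzero bases *)

Section exponential_polynomials.
Context {I : finType} (lam : I -> C).
Hypothesis lam_inj : injective lam.
Hypothesis lam_neq0 : forall j, lam j != 0.
Implicit Types Q : I -> {poly C}.

Definition exppoly Q (x : int) : C := \sum_j lam j ^ x * (Q j).[x%:~R].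

Lemma sdiff_exppoly z Q x :
  sdiff z (exppoly Q) x = exppoly (fun j => exp_sdiff z (lam j) (Q j)) x.
Proof.
rewrite /sdiff /exppoly mulr_sumr -sumrB; apply: eq_bigr => j _.
by rewrite -sdiff_exp.
Qed.

Lemma sdiffs_exppoly s Q : exists2 Q', sdiffs s (exppoly Q) = exppoly Q' &
  forall j, (size (Q' j) <= size (Q j) - count_mem (lam j) s)%N.
Proof.
elim: s Q => [|z s IHs] Q; first by exists Q => // j; rewrite subn0.
rewrite /= (_ : sdiff z (exppoly Q) = exppoly (fun j => exp_sdiff z (lam j) (Q j))).
  have [Q' -> sQ'] := IHs (fun j => exp_sdiff z (lam j) (Q j)).
  exists Q' => // j; rewrite (leq_trans (sQ' j))// subnDA leq_sub2r//.
  have [->|_] := eqVneq z (lam j); first by rewrite subn1 size_exp_sdiff_eq.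
  by rewrite subn0 size_exp_sdiff.
by apply/funext => x; rewrite sdiff_exppoly.
Qed.

Lemma sdiffs_exppoly_eq0 s Q x : (forall j, (size (Q j) <= count_mem (lam j) s)%N) ->
  sdiffs s (exppoly Q) x = 0.
Proof.
move=> sQ; have [Q' -> sQ'] := sdiffs_exppoly s Q.
apply: big1 => j _; have := sQ' j.
rewrite (eqP (sQ j : _ - _ == 0)%N) leqn0 size_poly_eq0 => /eqP ->.
by rewrite horner0 mulr0.
Qed.

(** Linear independence, by induction on the total size. Applying [E - lam i] with [Q i != 0]
    shortens [Q i], so all images vanish; the other components kept their sizes and are therefore
    zero, and [Q i] vanishes at infinitely many integers. *)
Lemma exppoly_eq0 (x0 : int) Q : (forall x, x0 <= x -> exppoly Q x = 0) ->
  forall j, Q j = 0.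
Proof.
have [n] := ubnP (\sum_j size (Q j))%N; elim: n Q => // n IHn Q Qn Q0.
have [/forallP allQ0 j0|] := boolP [forall j, Q j == 0]; first exact/eqP.
rewrite negb_forall => /existsP[i Qi].
have Q'0 j : exp_sdiff (lam i) (lam j) (Q j) = 0.
  apply: (IHn (fun j => exp_sdiff (lam i) (lam j) (Q j))) => [|x xx]; last first.
    by rewrite -sdiff_exppoly /sdiff !Q0 ?mulr0 ?subr0//; lia.
  rewrite ltnS in Qn; rewrite (leq_trans _ Qn)// (bigD1 i)//= [ltnRHS](bigD1 i)//=.
  rewrite -addSn leq_add//; last by apply: leq_sum => j' _; exact: size_exp_sdiff.
  have := size_exp_sdiff_eq (lam i) (Q i); have : size (Q i) != 0%N by rewrite size_poly_eq0.
  by case: (size (Q i)).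
have Qj j : j != i -> Q j = 0.
  move=> ji; apply/eqP; rewrite -size_poly_eq0 -(@size_exp_sdiff_neq (lam i) (lam j)).
    by rewrite Q'0 size_poly0.
  by apply: contra ji => /eqP/lam_inj ->.
have rQi x : x0 <= x -> root (Q i) x%:~R.
  move=> xx; have := Q0 x xx; rewrite /exppoly (bigD1 i)//= big1 => [|j ji]; last first.
    by rewrite Qj// horner0 mulr0.
  move/eqP; rewrite addr0 mulf_eq0 (negbTE (expfz_neq0 _ (lam_neq0 i)))/=.
  by move/eqP => h; apply/eqP.
have := @max_poly_roots _ (Q i) [seq (x0 + k%:Z)%:~R | k <- iota 0 (size (Q i))] Qi.
rewrite size_map size_iota ltnn => h; suff : false by [].
apply: h.
  by apply/allP => _ /mapP[k _ ->]; apply: rQi; lia.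
rewrite map_inj_uniq ?iota_uniq// => a b /eqP; rewrite eqr_int => /eqP.
by lia.
Qed.

(** The factors are integrated one at a time: [exp_sdiff_onto] supplies a particular solution [Q1],
    and what is left lies in the kernel of [E - z]. It is a multiple of [z ^ x], which joins the
    constant coefficient at the index [i] with [lam i = z]. *)
Lemma exppoly_of_sdiffs (x0 : int) s f : {subset s <= codom lam} ->
  (forall x, x0 <= x -> sdiffs s f x = 0) ->
  exists2 Q : I -> {poly C}, (forall j, (size (Q j) <= count_mem (lam j) s)%N) &
    forall x, x0 <= x -> f x = exppoly Q x.
Proof.
elim: s f => [|z s IHs] f slam fs.
  exists (fun=> 0) => [j|x xx]; first by rewrite size_poly0.
  by rewrite [LHS]fs// /exppoly big1// => j _; rewrite horner0 mulr0.
have [Q sQ QE] := IHs (sdiff z f) (fun t ts => slam t (@mem_behead _ (z :: s) t ts)) fs.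
have /codomP[i zi] := slam z (mem_head _ _).
have Q1 j : exists q : {poly C}, (size q <= count_mem (lam j) (z :: s))%N /\
    exp_sdiff z (lam j) q = Q j.
  have [q sq qQ] := exp_sdiff_onto z (lam_neq0 j) (sQ j).
  by exists q; split => //; rewrite /= addnC eq_sym.
have {}Q1 := boolp.choice Q1; have {Q1} [Q1 Q1P] := Q1.
pose g x := f x - exppoly Q1 x.
have g0 x : x0 <= x -> sdiff z g x = 0.
  move=> xx; have := QE x xx.
  rewrite (_ : exppoly Q x = sdiff z (exppoly Q1) x); last first.
    by rewrite sdiff_exppoly; apply: eq_bigr => j _; rewrite (Q1P j).2.
  move=> h; transitivity (sdiff z f x - sdiff z (exppoly Q1) x).
    by rewrite /sdiff /g; ring.
  by rewrite h subrr.
have z0 : z != 0 by rewrite zi.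
have gE := sdiff_eq0 z0 g0.
exists (fun j => Q1 j + (if j == i then (g x0 / z ^ x0)%:P else 0)) => [j|x xx].
  rewrite (leq_trans (size_polyD _ _))// geq_max (Q1P j).1 /=.
  case: eqP => [->|_]; last by rewrite size_poly0.
  by rewrite -zi eqxx (leq_trans (size_polyC_leq1 _)).
rewrite -[LHS](subrK (exppoly Q1 x)) -/(g x) gE// addrC /exppoly.
under [RHS]eq_bigr => j _ do rewrite hornerD mulrDr.
rewrite big_split /=; congr (_ + _).
rewrite (bigD1 i)//= eqxx hornerC big1 ?addr0 -?zi 1?mulrC// => j /negbTE ->.
by rewrite horner0 mulr0.
Qed.

End exponential_polynomials.
End linear_recurrences.

(** * Growth of geometric sequences and exponential polynomials *)

Section growth.
Context {R : realType}.
Implicit Types (f g : int -> R[i]) (z : R[i]) (s : seq R[i]).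

Definition linearly_bounded (x0 : int) f : Prop :=
  exists K : R, forall n : nat, `|f (x0 + n%:Z)| <= (K * n.+1%:R)%:C.

Lemma normC_real z : `|z| = (Normc.normc z)%:C.
Proof. by []. Qed.

Lemma linearly_bounded_sdiff x0 z f :
  linearly_bounded x0 f -> linearly_bounded x0 (sdiff z f).
Proof.
(* The 2 absorbs [n + 2 <= 2 * (n + 1)]. *)
move=> [K fK]; exists ((2 + Normc.normc z) * K) => n.
have K0 : 0 <= K.
  by have := le_trans (normr_ge0 _) (fK 0%N); rewrite lecR mulr1.
have nz0 : 0 <= Normc.normc z by have := normr_ge0 z; rewrite normC_real lecR.
rewrite /sdiff (le_trans (ler_normB _ _))// normrM.
have -> : x0 + n%:Z + 1 = x0 + n.+1%:Z by lia.
apply: (@le_trans _ _ ((K * n.+2%:R)%:C + `|z| * (K * n.+1%:R)%:C)).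
  by rewrite lerD// ler_wpM2l.
rewrite normC_real -rmorphM -rmorphD lecR /=.
rewrite -(natr1 n.+1).
have : 1 <= n.+1%:R :> R by rewrite ler1n.
by set t := n.+1%:R => t1; nra.
Qed.

(** Bernoulli's inequality, squared: a quadratic lower bound is enough to beat linear growth. *)
Lemma expr_quadratic_lb (e : R) n : 0 <= e -> (n%:R * e) ^+ 2 <= (1 + e) ^+ n.*2.
Proof.
move=> e0; rewrite -muln2 exprM; apply: lerXn2r; rewrite ?nnegrE ?exprn_ge0 ?mulr_ge0//; first lra.
elim: n => [|n IHn]; first by rewrite mul0r.
rewrite exprS -natr1 mulrDl mul1r mulrDl mul1r.
have : 1 <= (1 + e) ^+ n by apply: exprn_ege1; lra.
nra.
Qed.

(** By induction [sdiff z f] vanishes, so [f] is a multiple of [z ^ x]; as [|z| > 1], this outgrows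
    every linear bound unless it is zero. *)
Lemma linearly_bounded_sdiffs_eq0 x0 s f : {in s, forall z, 1 < `|z|} ->
  linearly_bounded x0 f -> (forall x, x0 <= x -> sdiffs s f x = 0) ->
  forall x, x0 <= x -> f x = 0.
Proof.
elim: s f => [|z s IHs] f s1 fb fs; first by move=> x /fs.
have z1 := s1 z (mem_head _ _).
have z0 : z != 0 by rewrite -normr_gt0 (lt_trans _ z1).
have /sdiff_eq0 fE : forall x, x0 <= x -> sdiff z f x = 0.
  apply: IHs => [t ts||]; [|exact: linearly_bounded_sdiff|exact: fs].
  by apply: s1; rewrite inE ts orbT.
have {}fE := fE z0.
suff f0 : f x0 = 0 by move=> x /fE ->; rewrite f0 mul0r mul0r.
have [K fK] := fb; apply: Normc.eq0_normc; apply/eqP; rewrite eq_le.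
have nf0 : 0 <= Normc.normc (f x0) by have := normr_ge0 (f x0); rewrite normC_real lecR.
rewrite nf0 andbT leNgt; apply/negP => fpos.
pose e := Normc.normc z - 1.
have e0 : 0 < e by move: z1; rewrite normC_real ltcR /e; lra.
have bnd n : Normc.normc (f x0) * (1 + e) ^+ n <= K * n.+1%:R.
  have := fK n; rewrite fE; last by lia.
  rewrite expfzDr// mulrA divfK ?expfz_neq0// normrM normrX normC_real.
  by rewrite -rmorphXn -rmorphM lecR /e addrC subrK.
have K0 : 0 <= K by have := bnd 0%N; rewrite expr0 !mulr1; lra.
(* At the index [2 * n] the two bounds give [|f x0| * e ^ 2 * n ^ 2 <= K * (2 * n + 1) <= 3 * K *
   n], which fails for [n] beyond this threshold. *)
have [n] : exists n : nat, 3 * K / (Normc.normc (f x0) * e ^+ 2) < n%:R.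
  exists (Num.bound (3 * K / (Normc.normc (f x0) * e ^+ 2))).
  by apply: archi_boundP; apply: divr_ge0; apply: mulr_ge0 => //; exact: sqr_ge0.
have fe : 0 < Normc.normc (f x0) * e ^+ 2 by rewrite mulr_gt0 ?exprn_gt0.
rewrite ltr_pdivrMr// => nK.
have n1 : 1 <= n%:R :> R.
  rewrite ler1n lt0n; apply/eqP => n0; move: nK; rewrite n0 mul0r; lra.
have := le_trans (ler_wpM2l nf0 (expr_quadratic_lb n (ltW e0))) (bnd n.*2).
rewrite exprMn -(natr1 n.*2) -muln2 natrM.
nra.
Qed.

(** Induction on the size of [q]: in [f (x + 1) = z * f x + sdiff z f x] the last term has a shorter
    polynomial factor, so it is bounded by some [M], and [|z| < 1] contracts the first. *)
Lemma exp_bounded x0 z (q : {poly R[i]}) : z != 0 -> `|z| < 1 ->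
  exists M : R, forall n : nat, `|z ^ (x0 + n%:Z) * q.[(x0 + n%:Z)%:~R]| <= M%:C.
Proof.
move=> z0 z1; have [d] := ubnP (size q); elim: d q => // d IHd q qd.
have [->|q0] := eqVneq q 0; first by exists 0 => n; rewrite horner0 mulr0 normr0.
have [|M MP] := IHd (exp_sdiff z z q).
  have := size_exp_sdiff_eq z q; have : size q != 0%N by rewrite size_poly_eq0.
  by case: (size q) qd => // k kd _ h; rewrite (leq_ltn_trans h).
pose f (x : int) := z ^ x * q.[x%:~R].
have r0 : 0 <= Normc.normc z by have := normr_ge0 z; rewrite normC_real lecR.
have r1 : Normc.normc z < 1 by move: z1; rewrite normC_real ltcR.
have M0 : 0 <= M by have := le_trans (normr_ge0 _) (MP 0%N); rewrite lecR.
have D0 : 0 <= M / (1 - Normc.normc z) by rewrite divr_ge0//; lra.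
have DE : M / (1 - Normc.normc z) * (1 - Normc.normc z) = M by rewrite divfK// gt_eqF//; lra.
have a0 : 0 <= Normc.normc (f x0) by have := normr_ge0 (f x0); rewrite normC_real lecR.
(* [M / (1 - |z|)] is the fixed point of [t -> M + |z| * t]. *)
exists (Normc.normc (f x0) + M / (1 - Normc.normc z)) => n; rewrite -/(f _).
elim: n => [|n IHn]; first by rewrite addr0 normC_real lecR lerDl.
have -> : f (x0 + n.+1%:Z) = sdiff z f (x0 + n%:Z) + z * f (x0 + n%:Z).
  by rewrite /sdiff subrK; congr f; lia.
rewrite (le_trans (ler_normD _ _))// [`|z * _|]normrM.
have Mn := MP n; rewrite -sdiff_exp// in Mn.
apply: le_trans (lerD Mn (ler_wpM2l (normr_ge0 z) IHn)) _.
rewrite [`|z|]normC_real -rmorphM -rmorphD lecR /=.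
move: DE D0; set D := M / _; nra.
Qed.

End growth.

(** * Survival probabilities, and the expected runtime as their sum *)

Section survival.
Import numFieldNormedType.Exports.
Local Open Scope classical_set_scope.
Context {R : realType} (P : rw_program R).
Local Notation N := (rw_k P + rw_m P).+1.
Local Notation step i := ((i : nat)%:Z - (rw_k P)%:Z).

(* The probability that the run started at [x] is still positive at time [n]. *)
Fixpoint surv (n : nat) (x : int) : R :=
  if 0 < x then
    if n is n'.+1 then \sum_(i < N) rw_p P (step i) * surv n' (x + step i) else 1
  else 0.

Lemma surv_le0 n x : x <= 0 -> surv n x = 0.
Proof. by case: n => [|n] /=; rewrite ltNge => ->. Qed.

Lemma rw_p_step_ge0 (i : 'I_N) : 0 <= rw_p P (step i).
Proof. by apply: rw_p_ge0; have := ltn_ord i; lia. Qed.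

Lemma surv_ge0 n x : 0 <= surv n x.
Proof.
elim: n x => [|n IHn] x /=; case: ifP => // _.
by apply: sumr_ge0 => i _; rewrite mulr_ge0 ?rw_p_step_ge0.
Qed.

Definition alive (n : nat) : set run := [set w | forall i, (i <= n)%N -> 0 < w i].

(** Fixing the past [s] up to time [l] makes room for the Markov property in an induction on [n]. *)
Definition alive_from (l n : nat) (s : nat -> int) : set run :=
  [set w | cylinder l s w /\ forall i, (l <= i <= l + n)%N -> 0 < w i].

Lemma measurable_cylinder n s : measurable (cylinder n s : set run).
Proof. by apply: sub_gen_smallest; exists n, s. Qed.

(** Membership depends on the first [i + 1] values only, and finite sequences of integers are
    countable, so the set is a countable union of cylinders. *)
Lemma measurable_coord i (A : set int) : measurable [set w : run | A (w i)].
Proof.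
rewrite (_ : [set _ | _] = \bigcup_(t : seq int)
    (if `[< A (nth 0 t i) >] then cylinder i (nth 0 t) : set run else set0)).
  apply: countable_bigcupT_measurable => [|t]; first exact: countableP.
  by case: ifP => // _; exact: measurable_cylinder.
apply/seteqP; split => w /=.
  move=> Aw; exists (mkseq w i.+1) => //.
  rewrite nth_mkseq// asboolT// => j ji.
  by rewrite nth_mkseq.
by move=> [t _]; case: ifPn => // /asboolP At /(_ i (leqnn i)) ->.
Qed.

Lemma measurable_alive_from l n s : measurable (alive_from l n s).
Proof.
rewrite (_ : alive_from l n s = cylinder l s `&`
    \bigcap_(i in [set i | (l <= i <= l + n)%N]) [set w : run | 0 < w i]).
  apply: measurableI; first exact: measurable_cylinder.
  apply: bigcap_measurable => [|i _]; last exact: (measurable_coord i [set z | 0 < z]).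
  by exists l => /=; rewrite leqnn leq_addr.
by [].
Qed.

Lemma measurable_alive n : measurable (alive n).
Proof.
apply: (@bigcap_measurable _ _ _ [set i | (i <= n)%N]) => [|i _].
  by exists 0%N.
exact: (measurable_coord i [set z | 0 < z]).
Qed.

(** A sum over states becomes a sum over branches: branches with a common target are already added
    up in [rw_trans], and [F] contains every target. *)
Lemma sum_trans (y : int) (F : seq int) (g : int -> R) : 0 < y -> uniq F ->
  rw_d P \in F -> (forall i : 'I_N, y + step i \in F) ->
  \sum_(z <- F) rw_trans P y z * g z =
  \sum_(i < N) rw_p P (step i) * g (y + step i) + rw_p' P * g (rw_d P).
Proof.
move=> y0 uF dF iF.
have pick a (c : R) : a \in F -> \sum_(z <- F) (if z == a then c else 0) * g z = c * g a.
  move=> aF; rewrite (bigD1_seq a)//= eqxx big1 ?addr0// => z /negbTE ->.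
  by rewrite mul0r.
under eq_bigr => z _ do rewrite /rw_trans y0 mulrDl mulr_suml.
rewrite big_split /= pick//; congr (_ + _).
by rewrite exchange_big /=; apply: eq_bigr => i _; rewrite pick.
Qed.

(** The Markov property, by induction on [n]: the cylinder is split according to the state at time
    [l + 1], and the induction hypothesis applies to each longer cylinder. *)
Lemma run_measure_alive_from (Q : probability run R) x l n s :
  is_run_measure P x Q ->
  Q (alive_from l n s) = (Q (cylinder l s) * (surv n (s l))%:E)%E.
Proof.
move=> HQ; elim: n l s => [|n IHn] l s.
  rewrite /=; case: ifPn => sl.
    rewrite mule1; congr (Q _); apply/seteqP; split => [w [] //|w ws]; split => // i.
    rewrite addn0 => /andP[li il]; have -> : i = l by lia.
    by rewrite ws.
  rewrite mule0 (_ : alive_from _ _ _ = set0) ?measure0//.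
  apply/seteqP; split => // w [ws] /(_ l); rewrite ws// addn0 leqnn => /(_ isT).
  by rewrite (negbTE sl).
rewrite /=; case: ifPn => sl; last first.
  rewrite mule0 (_ : alive_from _ _ _ = set0) ?measure0//.
  apply/seteqP; split => // w [ws] /(_ l); rewrite ws// leqnn leq_addr => /(_ isT).
  by rewrite (negbTE sl).
(* The possible successors of [s l]; [undup] since several branches may share a target. *)
pose F := undup (rw_d P :: [seq s l + step (nat_of_ord i) | i <- enum 'I_N]).
pose s' z i : int := if (i <= l)%N then s i else z.
have uF : uniq F by exact: undup_uniq.
have dF : rw_d P \in F by rewrite mem_undup mem_head.
have iF (i : 'I_N) : s l + step i \in F.
  by rewrite mem_undup inE; apply/orP; right; apply/mapP; exists i; rewrite ?mem_enum.
have s'l z : s' z l.+1 = z by rewrite /s' ltnn.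
pose q : R := if s 0%N == x then \prod_(i < l) rw_trans P (s i) (s i.+1) else 0.
have Qs : Q (cylinder l s) = q%:E by exact: HQ.
have Qs' z : Q (cylinder l.+1 (s' z)) = (q * rw_trans P (s l) z)%:E.
  rewrite HQ /q /s' leq0n; case: ifP => _; last by rewrite mul0r.
  rewrite big_ord_recr /= leqnn ltnn; congr (_ * _)%:E; apply: eq_bigr => i _.
  by rewrite (ltnW (ltn_ord i)) ltn_ord.
have triv (A : int -> set run) : (forall z, A z `<=` cylinder l.+1 (s' z)) ->
    trivIset [set` F] A.
  move=> Acyl; apply/trivIsetP => a b _ _ /eqP ab; apply/seteqP; split => // w [].
  move=> /Acyl /(_ l.+1 (leqnn _)) wa /Acyl /(_ l.+1 (leqnn _)) wb.
  by apply: ab; rewrite -(s'l a) -(s'l b) -wa -wb.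
have Qbig (A : int -> set run) (c : int -> R) :
    (forall z, A z `<=` cylinder l.+1 (s' z)) -> (forall z, measurable (A z)) ->
    (forall z, Q (A z) = (c z)%:E) ->
    Q (\bigcup_(z in [set` F]) A z) = (\sum_(z <- F) c z)%:E.
  move=> Acyl mA QA; rewrite measure_fin_bigcup; [|exact: finite_seq|exact: triv|by []].
  rewrite -fsbig_seq//= -sumEFin.
  by apply: eq_bigr => z _; rewrite QA.
pose U := \bigcup_(z in [set` F]) (cylinder l.+1 (s' z) : set run).
have mU : measurable U.
  by apply: fin_bigcup_measurable => [|z _]; [exact: finite_seq|exact: measurable_cylinder].
have mC := @measurable_cylinder l s.
have UC : U `<=` cylinder l s.
  by move=> w [z _ wz] i il; rewrite wz 1?ltnW// /s' il.
have QU : Q U = q%:E.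
  rewrite (Qbig (fun z => cylinder l.+1 (s' z)) (fun z => q * rw_trans P (s l) z));
    [|by move=> z w|by move=> z; exact: measurable_cylinder|exact: Qs'].
  rewrite -mulr_sumr (_ : \sum_(z <- F) _ = 1) ?mulr1//.
  transitivity (\sum_(z <- F) rw_trans P (s l) z * (fun=> 1) z).
    by apply: eq_bigr => z _; rewrite mulr1.
  rewrite sum_trans// mulr1 -[RHS](rw_sum1 P); congr (_ + _).
  by apply: eq_bigr => i _; rewrite mulr1.
(* The transition probabilities out of [s l] sum to 1, so almost every run of the cylinder has its
   next state in [F]. *)
have QD : Q (cylinder l s `\` U) = 0%E.
  have Qfin : (Q (cylinder l s) < +oo)%E by rewrite Qs ltry.
  rewrite (measureD mC mU Qfin) setIidr//.
  apply: (@etrans _ _ (q%:E - q%:E)%E); last by rewrite -EFinD subrr.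
  by congr (_ - _)%E.
have mA := measurable_alive_from l n.+1 s.
have -> : Q (alive_from l n.+1 s) = Q (alive_from l n.+1 s `&` U).
  apply: (etrans (measureDI Q mA mU)); rewrite -[RHS]add0e; congr (_ + _)%E.
  apply: (subset_measure0 _ _ _ QD); [exact: measurableD|exact: measurableD|].
  by move=> w [[]].
rewrite (_ : _ `&` U = \bigcup_(z in [set` F]) alive_from l.+1 n (s' z)); last first.
  apply/seteqP; split => w.
    move=> [[ws wp] [z zF wz]]; exists z => //; split => // i il.
    by apply: wp; lia.
  move=> [z zF [wz wp]]; split; last by exists z.
  split; first by apply: UC; exists z.
  move=> i il; have [->|li] := eqVneq i l.
    by rewrite wz// /s' leqnn.
  by apply: wp; lia.
rewrite (Qbig _ (fun z => q * (rw_trans P (s l) z * surv n z))); first last.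
- by move=> z; rewrite IHn Qs' s'l -EFinM mulrA.
- by move=> z; exact: measurable_alive_from.
- by move=> z w [].
(* The jump to [rw_d P] ends the run, so its term vanishes. *)
rewrite Qs -EFinM -mulr_sumr sum_trans// (surv_le0 _ (rw_d_le0 P)) mulr0 addr0.
by [].
Qed.

Lemma run_measure_alive x n : run_measure P x (alive n) = (surv n x)%:E.
Proof.
have HQ := run_measureP P x; set Q := run_measure P x.
have C1 : Q (cylinder 0 (fun=> x)) = 1%E by rewrite HQ eqxx big_ord0.
have mC := @measurable_cylinder 0 (fun=> x).
have mA := measurable_alive n.
have -> : Q (alive n) = Q (alive n `&` cylinder 0 (fun=> x)).
  apply: (etrans (measureDI Q mA mC)); rewrite -[RHS]add0e; congr (_ + _)%E.
  apply: (@subset_measure0 _ _ _ Q _ (~` (cylinder 0 (fun=> x) : set run))).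
  - exact: measurableD.
  - exact: measurableC.
  - by move=> w [].
  - apply: (etrans (probability_setC Q mC)); apply: (@etrans _ _ (1 - 1)%E).
      by congr (_ - _)%E.
    by rewrite subee.
rewrite (_ : _ `&` _ = alive_from 0 n (fun=> x)).
  by rewrite (run_measure_alive_from _ _ _ HQ) C1 mul1e.
by apply/seteqP; split => w [].
Qed.

(** The layer formula: [T] is the sum over [n] of the indicators of [T > n], and [T > n] is the
    event [alive n]. If the run stays positive forever, both sides are [+oo]. *)
Lemma termination_timeE (w : run) :
  termination_time w = (\sum_(0 <= n <oo) (\1_(alive n) w)%:E)%E :> \bar R.
Proof.
have [[n wn]|wpos] := pselect (exists n, w n <= 0); last first.
  rewrite /termination_time (_ : [set n | _] = set0); last first.
    by apply/seteqP; split => // n /= wn; apply: wpos; exists n.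
  rewrite image_set0 ereal_inf0; apply/esym.
  have -> : (\sum_(0 <= n <oo) (\1_(alive n) w)%:E = \sum_(0 <= n <oo) (1 : \bar R))%E.
    apply: eq_eseriesr => n _; rewrite indicE mem_set// => i _.
    by rewrite ltNge; apply/negP => wi; apply: wpos; exists i.
  apply: eq_infty => A.
  apply: le_trans (nneseries_lim_ge (Num.bound `|A|) _) => //.
  by rewrite sumEFin sumr_const_nat subn0 lee_fin (le_trans (ler_norm A))// ltW// archi_boundP.
pose m := ex_minn (ex_intro (fun n => w n <= 0) n wn).
have [wm mmin] : w m <= 0 /\ forall i, w i <= 0 -> (m <= i)%N.
  by rewrite /m; case: ex_minnP.
have al j : \1_(alive j) w = (j < m)%N%:R :> R.
  rewrite indicE; congr ((nat_of_bool _)%:R); apply/idP/idP.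
    rewrite inE => /(_ m); rewrite ltNge wm => h; rewrite ltnNge; apply/negP => mj.
    by have := h mj.
  move=> jm; rewrite mem_set// => i ij; rewrite ltNge; apply/negP => wi.
  by have := mmin i wi; lia.
rewrite (nneseries_split 0 m) => [|k _]; last by rewrite lee_fin al.
rewrite add0n [X in (_ + X)%E]eseries0 => [|i mi _]; last by rewrite al ltnNge mi.
rewrite adde0 (eq_big_nat _ _ (F2 := fun=> 1%E)) => [|i /andP[_ im]]; last by rewrite al im.
rewrite sumEFin sumr_const_nat subn0.
apply/eqP; rewrite eq_le; apply/andP; split.
  by apply: ereal_inf_lbound; exists m.
apply: le_ereal_inf_tmp => _ [j /= wj <-]; rewrite lee_fin ler_nat.
exact: mmin.
Qed.

(** Monotone convergence integrates the layer formula term by term; finiteness rules out the value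
    [+oo] set by convention. *)
Lemma expected_runtimeE x : (expected_runtime P x < +oo)%E ->
  expected_runtime P x = (\sum_(0 <= n <oo) (surv n x)%:E)%E.
Proof.
rewrite /expected_runtime; case: ifP => // _ _.
under eq_integral => w _ do rewrite termination_timeE.
rewrite integral_nneseries//.
- apply: eq_eseriesr => n _; rewrite integral_indic ?setIT//.
    exact: run_measure_alive.
  exact: measurable_alive.
- by move=> n; apply/measurable_EFinP; apply: measurable_indic; exact: measurable_alive.
Qed.

(** * The first-step recurrence, its bounded solutions, and upper bounds on the runtime *)

Section runtime.
Hypothesis hP : positively_ast P.

Definition rt (x : int) : R := fine (expected_runtime P x).

Lemma expected_runtime_rt x : expected_runtime P x = (rt x)%:E.
Proof.
rewrite /rt fineK// ge0_fin_numE ?hP// expected_runtimeE ?hP//.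
by apply: nneseries_ge0 => n _ _; rewrite lee_fin surv_ge0.
Qed.

Lemma rt_series x : (\sum_(0 <= n <oo) (surv n x)%:E)%E = (rt x)%:E.
Proof. by rewrite -expected_runtimeE ?hP// expected_runtime_rt. Qed.

Lemma sum_surv_le_rt x n : \sum_(i < n) surv i x <= rt x.
Proof.
rewrite -lee_fin -rt_series -(big_mkord xpredT (fun i => surv i x)) -sumEFin.
by apply: nneseries_lim_ge => i _ _; rewrite lee_fin surv_ge0.
Qed.

Lemma rt_ge0 x : 0 <= rt x.
Proof. by have := sum_surv_le_rt x 0; rewrite big_ord0. Qed.

Lemma rt_le x (K : R) : (forall n, \sum_(i < n) surv i x <= K) -> rt x <= K.
Proof.
move=> sK; rewrite -lee_fin -rt_series; apply: lime_le.
  by apply: is_cvg_nneseries => n _ _; rewrite lee_fin surv_ge0.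
by apply: nearW => n; rewrite /= sumEFin lee_fin big_mkord.
Qed.

Lemma rt_le0 x : x <= 0 -> rt x = 0.
Proof.
move=> x0; apply/eqP; rewrite eq_le rt_ge0 andbT; apply: rt_le => n.
by rewrite big1// => i _; rewrite surv_le0.
Qed.

(** First-step analysis: the term [n = 0] contributes 1 and the others are expanded by [surv]. The
    jump to [rw_d P] leaves no term because the runtime is 0 there. *)
Lemma rt_rec x : 0 < x -> rt x = 1 + \sum_(i < N) rw_p P (step i) * rt (x + step i).
Proof.
move=> x0; apply: EFin_inj; rewrite -rt_series nneseries_recl//; last first.
  by move=> k _; rewrite lee_fin surv_ge0.
rewrite /= x0 EFinD; congr (_ + _)%E.
rewrite -nneseries_addn; last by move=> k; rewrite lee_fin surv_ge0.
under eq_eseriesr => n _ do rewrite addn1 /= x0 -sumEFin.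
rewrite nneseries_sum => [|i n _]; last first.
  by rewrite lee_fin mulr_ge0 ?rw_p_step_ge0 ?surv_ge0.
rewrite -sumEFin; apply: eq_bigr => i _.
under eq_eseriesr => n _ do rewrite EFinM.
by rewrite nneseriesZl ?rt_series ?EFinM// => n _; rewrite lee_fin surv_ge0.
Qed.

Lemma surv_small x (e : R) : 0 < e -> exists n, surv n x < e.
Proof.
move=> e0; apply: contrapT => /forallNP sge.
have {}sge n : e <= surv n x by rewrite leNgt; apply/negP.
have [n] : exists n : nat, rt x / e < n%:R.
  by exists (Num.bound (rt x / e)); apply: archi_boundP; rewrite divr_ge0 ?rt_ge0 ?ltW.
rewrite ltr_pdivrMr// => nrt; have := sum_surv_le_rt x n; apply/negP; rewrite -ltNge.
rewrite (lt_le_trans nrt)// (_ : n%:R * e = \sum_(i < n) e).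
  by apply: ler_sum => i _.
by rewrite sumr_const card_ord mulr_natl.
Qed.

(** Iterating the recurrence [n] times gives [|h x| <= M * surv n x], and survival probabilities
    become arbitrarily small. *)
Lemma bounded_killed_harmonic_eq0 (h : int -> R[i]) (M : R) :
  (forall x, x <= 0 -> h x = 0) ->
  (forall x, 0 < x -> h x = \sum_(i < N) (rw_p P (step i))%:C * h (x + step i)) ->
  (forall x, `|h x| <= M%:C) -> forall x, h x = 0.
Proof.
move=> h0 hrec hM x.
have M0 : 0 <= M by have := le_trans (normr_ge0 _) (hM 0); rewrite lecR.
have bnd n y : `|h y| <= (M * surv n y)%:C.
  elim: n y => [|n IHn] y.
    case: (ltP 0 y) => y0; last by rewrite h0// normr0 lecR surv_le0// mulr0.
    by rewrite /= y0 mulr1.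
  case: (ltP 0 y) => y0; last by rewrite h0// normr0 lecR surv_le0// mulr0.
  rewrite hrec//= y0 (le_trans (ler_norm_sum _ _ _))// mulr_sumr rmorph_sum /=.
  apply: ler_sum => i _; rewrite normrM ger0_norm ?lecR ?rw_p_step_ge0//.
  by rewrite mulrCA rmorphM ler_wpM2l// lecR rw_p_step_ge0.
apply/eqP; rewrite -normr_eq0 eq_le normr_ge0 andbT.
have [e e0 hxe] : exists2 e : R, 0 <= e & `|h x| = e%:C.
  exists (Normc.normc (h x)) => //.
  by have := normr_ge0 (h x); rewrite -[`|_|]/((Normc.normc (h x))%:C) lecR.
rewrite hxe lecR leNgt; apply/negP => e1.
have M1 : 0 < M + 1 by lra.
have [n] := surv_small x (divr_gt0 e1 M1); rewrite ltr_pdivlMr// => sn.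
have := bnd n x; rewrite hxe lecR.
have := surv_ge0 n x; nra.
Qed.

Lemma sum_p : \sum_(i < N) rw_p P (step i) = 1 - rw_p' P.
Proof. by rewrite -(rw_sum1 P) addrK. Qed.

Lemma sum_p_affine (x : int) : rw_p' P = 0 ->
  \sum_(i < N) rw_p P (step i) * (x + step i)%:~R = x%:~R + rw_drift P.
Proof.
move=> p'0; under eq_bigr => i _ do rewrite intrD mulrDr.
rewrite big_split /= -mulr_suml sum_p p'0 subr0 mul1r; congr (_ + _).
by apply: eq_bigr => i _; rewrite mulrC.
Qed.

(* If the drift were nonnegative, the positive part of the walk killed at 0
   would be a submartingale growing by at most [rw_m] per step, which forces
   [surv n 1 >= 1 / (1 + n * rw_m)], and the harmonic series diverges. *)
Lemma drift_lt0 : rw_p' P = 0 -> rw_drift P < 0.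
Proof.
move=> p'0; rewrite ltNge; apply/negP => drift0.
have lb n (x : int) (M : R) : x%:~R + (n * rw_m P)%:R <= M -> 0 <= M ->
    x%:~R <= M * surv n x.
  elim: n x => [|n IHn] x xM M0; case: (ltP 0 x) => x0; try
    by rewrite surv_le0// mulr0 (ler_int _ _ 0).
    by rewrite /= x0 mulr1; move: xM; rewrite mul0n addr0.
  rewrite /= x0 mulr_sumr (@le_trans _ _ (x%:~R + rw_drift P)) ?lerDl//.
  rewrite -sum_p_affine//; apply: ler_sum => i _.
  rewrite mulrCA ler_wpM2l ?rw_p_step_ge0// IHn// (le_trans _ xM)//.
  rewrite !pmulrn -!intrD ler_int.
  have := ltn_ord i; lia.
(* Here [M = (1 + m) * (n + 1)], which dominates [1 + n * m]. *)
have lb1 n : harmonic n <= (1 + (rw_m P)%:R) * surv n 1.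
  rewrite /harmonic /= -[leLHS]mul1r ler_pdivrMr ?ltr0n// mulrAC.
  apply: (lb n 1) => //.
  rewrite natrM -(natr1 n).
  have n0 : 0 <= n%:R :> R by [].
  have m0 : 0 <= (rw_m P)%:R :> R by [].
  by rewrite (_ : 1%:~R = 1 :> R)//; lra.
apply: (@dvg_harmonic R).
apply: (series_le_cvg _ _ lb1).
- by move=> n; rewrite invr_ge0.
- by move=> n; rewrite mulr_ge0 ?surv_ge0// addr_ge0.
apply: nondecreasing_is_cvgn.
  by apply: nondecreasing_series => n _ _; rewrite mulr_ge0 ?surv_ge0// addr_ge0.
exists ((1 + (rw_m P)%:R) * rt 1) => _ [n _ <-].
by rewrite /series /= -mulr_sumr ler_wpM2l ?addr_ge0// big_mkord sum_surv_le_rt.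
Qed.

(** The partial sums of the series for [rt] arise from 0 by iterating the recurrence, and they stay
    below [f]. Steps from [x > 0] end above [- rw_k P], so [f] may be negative further left. *)
Lemma rt_le_supersolution (f : int -> R) :
  (forall x, - (rw_k P)%:Z <= x -> 0 <= f x) ->
  (forall x, 0 < x -> 1 + \sum_(i < N) rw_p P (step i) * f (x + step i) <= f x) ->
  forall x, - (rw_k P)%:Z <= x -> rt x <= f x.
Proof.
move=> f0 fsup x xk; apply: rt_le => n; elim: n x xk => [|n IHn] x xk.
  by rewrite big_ord0 f0.
case: (ltP 0 x) => x0; last by rewrite big1 ?f0// => i _; rewrite surv_le0.
rewrite (le_trans _ (fsup x x0))// big_ord_recl /= x0 lerD2l.
rewrite exchange_big /=; apply: ler_sum => i _; rewrite -mulr_sumr.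
by rewrite ler_wpM2l ?rw_p_step_ge0// IHn//; have := ltn_ord i; lia.
Qed.

Lemma rt_le_invp' x : 0 < rw_p' P -> rt x <= 1 / rw_p' P.
Proof.
move=> p'0; case: (ltP 0 x) => x0; last by rewrite rt_le0// divr_ge0// ltW.
apply: (@rt_le_supersolution (fun=> 1 / rw_p' P)) => [y _|y _|]; last by lia.
  by rewrite divr_ge0// ltW.
by rewrite -mulr_suml sum_p le_eqVlt; apply/orP; left; apply/eqP; field; rewrite gt_eqF.
Qed.

(** The bound is an affine solution of the recurrence, translated by [rw_k P] to be nonnegative on
    the relevant range. *)
Lemma rt_le_affine x : rw_p' P = 0 -> - (rw_k P)%:Z <= x ->
  rt x <= - (1 / rw_drift P) * (x + (rw_k P)%:Z)%:~R.
Proof.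
move=> p'0 xk; have dr := drift_lt0 p'0.
have dr0 : 0 <= - (1 / rw_drift P) by rewrite -mulrN -invrN divr_ge0// oppr_ge0 ltW.
apply: (@rt_le_supersolution (fun y => - (1 / rw_drift P) * (y + (rw_k P)%:Z)%:~R)) => //.
  by move=> y yk; rewrite mulr_ge0// (ler_int _ 0); lia.
move=> y y0; under eq_bigr => i _ do rewrite mulrCA addrAC.
rewrite -mulr_sumr sum_p_affine// mulrDr le_eqVlt; apply/orP; left; apply/eqP.
by field; rewrite lt_eqF.
Qed.

(** Without downward steps the drift could not be negative. *)
Lemma rw_k_gt0 : rw_p' P = 0 -> (0 < rw_k P)%N.
Proof.
move=> /drift_lt0; rewrite lt0n; apply: contraTneq => k0; rewrite -leNgt.
apply: sumr_ge0 => i _; rewrite mulr_ge0 ?rw_p_step_ge0// (ler_int _ 0).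
by lia.
Qed.

Lemma rt_k0 x : rw_k P = 0%N -> 0 < x -> rt x = 1 / rw_p' P.
Proof.
move=> k0 x0; have p'0 : 0 < rw_p' P.
  rewrite lt_def rw_p'_ge0 andbT; apply/eqP => /rw_k_gt0; by rewrite k0.
pose h (y : int) : R[i] := if 0 < y then (rt y - 1 / rw_p' P)%:C else 0.
suff : h x = 0 by rewrite /h x0 => /complexI/eqP; rewrite subr_eq0 => /eqP.
apply: (@bounded_killed_harmonic_eq0 h (1 / rw_p' P)).
- by move=> y; rewrite /h ltNge => ->.
- move=> y y0; rewrite {1}/h y0 rt_rec//.
  (* With [k = 0] no step leaves the positive integers, so the cut-off at 0 does not disturb the
     recurrence. *)
  have hE (i : 'I_N) : h (y + step i) = (rt (y + step i) - 1 / rw_p' P)%:C.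
    by rewrite /h ifT//; lia.
  under [RHS]eq_bigr => i _ do rewrite hE -rmorphM mulrBr.
  rewrite -rmorph_sum sumrB -mulr_suml sum_p /=; congr (_%:C).
  by field; rewrite gt_eqF.
- move=> y; have p'1 : 0 <= 1 / rw_p' P by rewrite divr_ge0// ltW.
  rewrite /h; case: ifP => _; last by rewrite normr0 lecR.
  rewrite normc_def /= expr0n /= addr0 sqrtr_sqr lecR ler_norml.
  by have := rt_ge0 y; have := rt_le_invp' y p'0; lra.
Qed.

(** [rw_C P] solves the same inhomogeneous recurrence on all integers, so the constant 1 cancels. *)
Lemma rt_sub_C_rec x : 0 < x ->
  rt x - rw_C P x = \sum_(i < N) rw_p P (step i) * (rt (x + step i) - rw_C P (x + step i)).
Proof.
move=> x0; under eq_bigr => i _ do rewrite mulrBr.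
rewrite sumrB rt_rec// /rw_C; case: ltP => p'0.
  by rewrite -mulr_suml sum_p; field; rewrite gt_eqF.
have {}p'0 : rw_p' P = 0 by apply/eqP; rewrite eq_le p'0 rw_p'_ge0.
have -> : \sum_(i < N) rw_p P (step i) * (- (1 / rw_drift P) * (x + step i)%:~R) =
    - (1 / rw_drift P) * (x%:~R + rw_drift P).
  under eq_bigr => i _ do rewrite mulrCA.
  by rewrite -mulr_sumr sum_p_affine.
by field; rewrite lt_eqF// drift_lt0.
Qed.

(** For [p' > 0] both terms are bounded. Otherwise, with [D = - 1 / drift], [rt] lies between 0 and
    [D * (x + k)], and [rw_C P x = D * x]. The starting point [1 - k] is the lowest one that a step
    from [x > 0] can reach. *)
Lemma rt_sub_C_growth : exists K : R, forall n : nat,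
  `|rt (1 - (rw_k P)%:Z + n%:Z) - rw_C P (1 - (rw_k P)%:Z + n%:Z)| <= K * n.+1%:R.
Proof.
have [p'0|p'0] := ltP 0 (rw_p' P).
  exists (1 / rw_p' P) => n; rewrite /rw_C p'0.
  set x := _ + n%:Z; have := rt_ge0 x; have := rt_le_invp' x p'0.
  have p'1 : 0 <= 1 / rw_p' P by rewrite divr_ge0// ltW.
  have n1 : 1 <= n.+1%:R :> R by rewrite ler1n.
  move=> h1 h2; rewrite (@le_trans _ _ (1 / rw_p' P))// ?ler_peMr//.
  by rewrite ler_norml; lra.
have {}p'0 : rw_p' P = 0 by apply/eqP; rewrite eq_le p'0 rw_p'_ge0.
have dr := drift_lt0 p'0.
have dr0 : 0 <= - (1 / rw_drift P) by rewrite -mulrN -invrN divr_ge0// oppr_ge0 ltW.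
exists (- (1 / rw_drift P) * (1 + (rw_k P)%:R)) => n; rewrite /rw_C p'0 ltxx.
set x := _ + n%:Z; have := rt_ge0 x.
have := @rt_le_affine x p'0 ltac:(lia).
have -> : (x + (rw_k P)%:Z)%:~R = n.+1%:R :> R.
  by rewrite pmulrn; congr (_%:~R); lia.
have -> : x%:~R = n.+1%:R - (rw_k P)%:R :> R.
  by rewrite !pmulrn -intrB; congr (_%:~R); lia.
have n1 : 1 <= n.+1%:R :> R by rewrite ler1n.
have k1 : 0 <= (rw_k P)%:R :> R by [].
move: dr0 n1 k1; set D := - _; set t := n.+1%:R; set k := (rw_k P)%:R.
move=> D0 t1 k1 h1 h2; rewrite ler_norml.
have Dk : 0 <= D * k by exact: mulr_ge0.
have Dkt : D * k <= D * k * t by rewrite ler_peMr.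
by apply/andP; split; lra.
Qed.

End runtime.
End survival.

(** * Roots of the characteristic polynomial *)

Section characteristic_polynomial.
Context {R : realType} (P : rw_program R).
Local Notation N := (rw_k P + rw_m P).+1.
Local Notation step i := ((i : nat)%:Z - (rw_k P)%:Z).
Local Notation chi := (rw_charpoly P).

Lemma charpolyE : chi = \poly_(i < N) (rw_p P (step i))%:C - 'X^(rw_k P).
Proof. by rewrite /rw_charpoly poly_def. Qed.

Lemma rw_k_ltN : (rw_k P < N)%N.
Proof. by rewrite ltnS leq_addr. Qed.

(** Thus [chi(E) f = 0] at [x] is the homogeneous recurrence for [f] at [x + rw_k P]. *)
Lemma shift_act_charpoly (f : int -> R[i]) x : shift_act chi f x =
  \sum_(i < N) (rw_p P (step i))%:C * f (x + i%:Z) - f (x + (rw_k P)%:Z).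
Proof.
rewrite (@shift_act_widen _ N); last first.
  rewrite charpolyE (leq_trans (size_polyD _ _))// geq_max size_poly size_polyN.
  by rewrite size_polyXn rw_k_ltN.
under eq_bigr => i _ do rewrite charpolyE coefB coef_poly ltn_ord coefXn mulrBl.
rewrite sumrB; congr (_ - _).
rewrite (bigD1 (Ordinal rw_k_ltN))//= eqxx mul1r big1 ?addr0// => i.
by rewrite -val_eqE /= => /negbTE ->; rewrite mul0r.
Qed.

Lemma horner_charpoly z : chi.[z] =
  \sum_(i < N) (rw_p P (step i))%:C * z ^+ i - z ^+ rw_k P.
Proof. by rewrite charpolyE hornerD hornerN hornerXn horner_poly. Qed.

Lemma horner_deriv_charpoly z : z * chi^`().[z] =
  \sum_(i < N) i%:R * (rw_p P (step i))%:C * z ^+ i - (rw_k P)%:R * z ^+ rw_k P.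
Proof.
have zX n : z * (z ^+ n.-1 *+ n) = n%:R * z ^+ n.
  by case: n => [|n]; rewrite ?mulr0n ?mulr0 ?mul0r// -mulr_natl mulrCA -exprS.
rewrite /rw_charpoly derivB derivXn raddf_sum hornerD hornerN horner_sum mulrBr.
rewrite hornerMn hornerXn zX; congr (_ - _); rewrite mulr_sumr; apply: eq_bigr => i _.
by rewrite /= derivZ derivXn hornerZ hornerMn hornerXn mulrCA zX mulrCA mulrA.
Qed.

Hypothesis hP : positively_ast P.

(** The constant coefficient is [p_{-k} > 0] if [k > 0], and [p_0 - 1] if [k = 0]; in the latter
    case [p_0 = 1] would force [p' = 0] and so, by termination, [k > 0]. *)
Lemma charpoly_root0 : ~~ root chi 0.
Proof.
rewrite rootE horner_charpoly big_ord_recl /= expr0 mulr1 sub0r.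
rewrite big1 ?addr0 => [|i _]; last by rewrite expr0n mulr0.
have [k0|k0] := posnP (rw_k P); last first.
  rewrite expr0n gtn_eqF// subr0; apply/eqP => /complexI p0.
  by have := rw_pk_gt0 k0; rewrite p0 ltxx.
rewrite (_ : 0 ^+ rw_k P = 1) ?k0 ?expr0// -k0 subr_eq0; apply/eqP => /complexI p1.
have p'0 : rw_p' P = 0.
  apply/eqP; rewrite eq_le rw_p'_ge0 andbT.
  have := rw_sum1 P; rewrite big_ord_recl /= sub0r p1 => h.
  suff : 0 <= \sum_(i < rw_k P + rw_m P) rw_p P (step (bump 0 i)) by lra.
  by apply: sumr_ge0 => i _; exact: (rw_p_step_ge0 (lift ord0 i)).
by have := rw_k_gt0 hP p'0; rewrite k0.
Qed.

Lemma charpoly_neq0 : chi != 0.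
Proof. by apply: contraNneq charpoly_root0 => ->; rewrite root0. Qed.

Lemma charpoly_root_sum z : root chi z ->
  \sum_(i < N) (rw_p P (step i))%:C * z ^+ i = z ^+ rw_k P.
Proof. by rewrite rootE horner_charpoly subr_eq0 => /eqP. Qed.

(* On the unit circle the triangle inequality is strict if [rw_p' P > 0]; if
   [rw_p' P = 0] its equality case makes all the nonzero terms of the sum
   aligned with [z ^+ rw_k P], whence [z * chi'(z) = drift * z ^+ rw_k P]. *)
Lemma mup_unit_root z : `|z| = 1 -> (mup z chi <= 1)%N.
Proof.
move=> z1; have [rz|] := boolP (root chi z); last by move/mupNroot => ->.
have z0 : z != 0 by rewrite -normr_gt0 z1.
have norm_term (i : 'I_N) : `|(rw_p P (step i))%:C * z ^+ i / z ^+ rw_k P| =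
    (rw_p P (step i))%:C.
  rewrite normrM normfV !normrX normrM normrX z1 !expr1n invr1 !mulr1.
  by rewrite ger0_norm// lecR rw_p_step_ge0.
have sum1 : \sum_(i < N) (rw_p P (step i))%:C * z ^+ i / z ^+ rw_k P = 1.
  by rewrite -mulr_suml charpoly_root_sum// divff// expf_neq0.
have p'0 : rw_p' P = 0.
  apply/eqP; rewrite eq_le rw_p'_ge0 andbT.
  have := ler_norm_sum (index_enum 'I_N)
    (fun i : 'I_N => (rw_p P (step i))%:C * z ^+ i / z ^+ rw_k P) xpredT.
  rewrite sum1 normr1 (eq_bigr _ (fun i _ => norm_term i)) -rmorph_sum /= sum_p.
  by rewrite -(rmorph1 (real_complex R)) lecR; lra.
have aligned (i : 'I_N) : (rw_p P (step i))%:C * z ^+ i = (rw_p P (step i))%:C * z ^+ rw_k P.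
  rewrite -[LHS](divfK (expf_neq0 (rw_k P) z0)); congr (_ * _).
  apply: (@normC_sum_upper _ _ xpredT
    (fun i : 'I_N => (rw_p P (step i))%:C * z ^+ i / z ^+ rw_k P)
    (fun i => (rw_p P (step i))%:C)) => // [j _|].
    by rewrite norm_term.
  by rewrite sum1 -rmorph_sum /= sum_p p'0 subr0.
(* A multiple root would also be a zero of the derivative. *)
rewrite mup_leq ?charpoly_neq0//; apply/negP => /dvdpP[q chiq].
have : z * chi^`().[z] = 0.
  rewrite chiq expr2 !derivM !(hornerD, hornerM, hornerXsubC).
  by rewrite hornerN hornerX hornerC subrr !(mul0r, mulr0, addr0).
rewrite horner_deriv_charpoly.
under eq_bigr => i _ do rewrite -mulrA aligned mulrA.
rewrite -mulr_suml -mulrBl => /eqP; rewrite mulf_eq0 expf_eq0 (negbTE z0) andbF orbF.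
apply/negP; rewrite (_ : _ - _ = (rw_drift P)%:C).
  by rewrite (inj_eq (@complexI R) _ 0) lt_eqF// drift_lt0.
rewrite /rw_drift; under [in RHS]eq_bigr => i _ do rewrite intrB mulrBl.
rewrite sumrB -mulr_sumr sum_p p'0 subr0 mulr1 rmorphB /=; congr (_ - _).
  rewrite rmorph_sum; apply: eq_bigr => i _.
  by rewrite rmorphM /= -pmulrn rmorph_nat.
by rewrite -pmulrn rmorph_nat.
Qed.

End characteristic_polynomial.

(** * Solutions as exponential polynomials over the closed unit disk *)

Section ansatz.
Context {R : realType} (P : rw_program R) (c : nat) (lam : 'I_c -> R[i]) (v : 'I_c -> nat).
Local Notation N := (rw_k P + rw_m P).+1.
Local Notation step i := ((i : nat)%:Z - (rw_k P)%:Z).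
Local Notation chi := (rw_charpoly P).

(** Roots outside the closed unit disk get the zero polynomial, which turns the restricted sum of
    the ansatz into a sum over all roots. *)
Definition coef_poly_family (b : 'I_c -> nat -> R[i]) (j : 'I_c) : {poly R[i]} :=
  if `|lam j| <= 1 then \poly_(u < v j) b j u else 0.

Lemma rw_ansatzE b x :
  rw_ansatz P lam v b x = (rw_C P x)%:C + exppoly lam (coef_poly_family b) x.
Proof.
rewrite /rw_ansatz /exppoly big_mkcond; congr (_ + _); apply: eq_bigr => j _.
rewrite /coef_poly_family; case: ifP => _; last by rewrite horner0 mulr0.
by rewrite horner_poly mulr_sumr; apply: eq_bigr => u _; rewrite mulrA (mulrC (b j u)).
Qed.

Lemma coef_poly_familyK (Q : 'I_c -> {poly R[i]}) :
  (forall j, (size (Q j) <= if (`|lam j| <= 1)%R then v j else 0)%N) ->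
  coef_poly_family (fun j u => (Q j)`_u) = Q.
Proof.
move=> sQ; apply/funext => j; have := sQ j; rewrite /coef_poly_family.
case: ifP => _ Qj; last by apply/esym/eqP; rewrite -size_poly_eq0 -leqn0.
apply/polyP => u; rewrite coef_poly; case: ltnP => // vu.
by rewrite nth_default// (leq_trans Qj).
Qed.

Lemma exppolyB (Q1 Q2 : 'I_c -> {poly R[i]}) x :
  exppoly lam (fun j => Q1 j - Q2 j) x = exppoly lam Q1 x - exppoly lam Q2 x.
Proof.
by rewrite -sumrB; apply: eq_bigr => j _; rewrite hornerD hornerN mulrBr.
Qed.

Hypothesis hP : positively_ast P.
Hypothesis lam_inj : injective lam.
Hypothesis lam_roots : forall z, root chi z <-> exists j, z = lam j.
Hypothesis v_mult : forall j, v j = mup (lam j) chi.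

Lemma lam_neq0 j : lam j != 0.
Proof.
apply: contraNneq (charpoly_root0 hP) => <-.
by apply/lam_roots; exists j.
Qed.

(** The roots, listed with multiplicity, are split by modulus; up to the nonzero leading
    coefficient, [chi(E)] is the composition of all factors [E - z]. Those of [r2] come outermost,
    ready to be cancelled. *)
Lemma charpoly_factorization : exists r1 r2 : seq R[i],
  [/\ {subset r1 <= codom lam}, {in r2, forall z, 1 < `|z|},
      forall j, count_mem (lam j) r1 = (if (`|lam j| <= 1)%R then v j else 0)%N &
      forall f x, (shift_act chi f x == 0) = (sdiffs r2 (sdiffs r1 f) x == 0)].
Proof.
have [r rE] := closed_field_poly_normal chi.
have l0 : lead_coef chi != 0 by rewrite lead_coef_eq0 charpoly_neq0.
exists [seq z <- r | `|z| <= 1], [seq z <- r | ~~ (`|z| <= 1)]; split.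
- move=> z; rewrite mem_filter => /andP[_ zr].
  have [|j ->] := (lam_roots z).1; last exact: codom_f.
  by rewrite rE rootZ// root_prod_XsubC.
- by move=> z; rewrite mem_filter real_ltNge ?normr_real ?real1// => /andP[].
- move=> j; rewrite count_filter v_mult [in mup _ _]rE.
  rewrite -mul_polyC mupM ?polyC_eq0//; last first.
    by apply/monic_neq0/monic_prod_XsubC.
  rewrite mupNroot ?rootC// add0n mu_prod_XsubC.
  have [l1|l1] := ifP.
    by apply: eq_count => z /=; case: eqP => //= ->.
  rewrite -(@count_pred0 _ r); apply: eq_count => z /=.
  by case: eqP => //= ->; rewrite l1.
- move=> f x; rewrite rE shift_actZ mulf_eq0 (negbTE l0)/= /sdiffs -foldl_cat -/(sdiffs _ _).
  rewrite -!shift_act_prod_XsubC; congr (shift_act _ f x == 0).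
  by apply: perm_big; rewrite perm_sym perm_filterC.
Qed.

Lemma exppoly_family_bounded (Q : 'I_c -> {poly R[i]}) :
  (forall j, (size (Q j) <= if (`|lam j| <= 1)%R then v j else 0)%N) ->
  exists M : R, forall x : int, 0 < x -> `|exppoly lam Q x| <= M%:C.
Proof.
move=> sQ.
have /boolp.choice[M MP] j : exists M : R, forall n : nat,
    `|lam j ^ (1 + n%:Z) * (Q j).[(1 + n%:Z)%:~R]| <= M%:C.
  have := sQ j; case: ifP => [l1 Qj|_]; last first.
    rewrite leqn0 size_poly_eq0 => /eqP ->.
    by exists 0 => n; rewrite horner0 mulr0 normr0.
  move: l1; rewrite le_eqVlt => /predU1P[l1|l1]; last exact: exp_bounded (lam_neq0 j) l1.
  (* On the unit circle the root is simple, so [Q j] is constant. *)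
  have /size1_polyC -> : (size (Q j) <= 1)%N.
    by rewrite (leq_trans Qj)// v_mult mup_unit_root.
  exists (Normc.normc (Q j)`_0) => n.
  by rewrite hornerC normrM -[1 + _]/((n.+1)%:Z) normrX l1 expr1n mul1r normC_real.
exists (\sum_j M j) => x x0; rewrite rmorph_sum (le_trans (ler_norm_sum _ _ _))//=.
apply: ler_sum => j _.
have -> : x = 1 + `|x - 1|%N%:Z by lia.
exact: MP.
Qed.

(** Cutting the combination off at 0 changes nothing for [x > - k], so the recurrence survives; the
    result is bounded, hence zero, and linear independence gives [Q = 0]. *)
Lemma killed_exppoly_eq0 (Q : 'I_c -> {poly R[i]}) :
  (forall j, (size (Q j) <= if (`|lam j| <= 1)%R then v j else 0)%N) ->
  (forall x, - (rw_k P)%:Z + 1 <= x <= 0 -> exppoly lam Q x = 0) ->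
  forall j, Q j = 0.
Proof.
move=> sQ Q0; have [r1 [r2 [_ _ cr1 chiE]]] := charpoly_factorization.
have rec x : shift_act chi (exppoly lam Q) x = 0.
  apply/eqP; rewrite chiE -[sdiffs r2 _]/(foldl _ _ _) -foldl_cat -/(sdiffs _ _).
  apply/eqP; apply: (sdiffs_exppoly_eq0 lam_neq0) => j.
  by rewrite count_cat cr1 (leq_trans (sQ j))// leq_addr.
have [M MP] := exppoly_family_bounded sQ.
pose h (x : int) := if 0 < x then exppoly lam Q x else 0.
have hE x : - (rw_k P)%:Z + 1 <= x -> exppoly lam Q x = h x.
  by move=> xk; rewrite /h; case: ltP => // x0; rewrite Q0// xk x0.
have h0 x : h x = 0.
  apply: (bounded_killed_harmonic_eq0 hP (h := h) (M := Num.max M 0)).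
  - by move=> y; rewrite /h ltNge => ->.
  - move=> y y0; have := rec (y - (rw_k P)%:Z); rewrite shift_act_charpoly => /eqP.
    rewrite subrK subr_eq0 => /eqP; rewrite -hE; last by lia.
    move=> <-; apply: eq_bigr => i _; rewrite -hE; last by lia.
    by rewrite addrAC addrA.
  - move=> y; rewrite /h; case: ifP => [y0|_].
      by rewrite (le_trans (MP y y0))// lecR le_max lexx.
    by rewrite normr0 lecR le_max lexx orbT.
by apply: (exppoly_eq0 lam_inj lam_neq0 (x0 := - (rw_k P)%:Z + 1)) => x /hE ->.
Qed.

(** For [x > - k] the recurrence holds at [x + k > 0], so all factors together annihilate
    [g = rt - C]. The factors of [r1] leave a linearly bounded function annihilated by those of
    [r2], hence zero; so [r1] alone annihilates [g]. *)
Lemma rt_exppoly : exists2 Q : 'I_c -> {poly R[i]},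
  (forall j, (size (Q j) <= if (`|lam j| <= 1)%R then v j else 0)%N) &
  forall x, - (rw_k P)%:Z + 1 <= x -> (rt P x)%:C = (rw_C P x)%:C + exppoly lam Q x.
Proof.
have [r1 [r2 [r1lam r2gt cr1 chiE]]] := charpoly_factorization.
pose g x : R[i] := (rt P x - rw_C P x)%:C.
have g0 x : - (rw_k P)%:Z + 1 <= x -> sdiffs r2 (sdiffs r1 g) x = 0.
  move=> xk; apply/eqP; rewrite -chiE shift_act_charpoly subr_eq0 {2}/g.
  rewrite (rt_sub_C_rec hP); last by lia.
  rewrite rmorph_sum; apply/eqP; apply: eq_bigr => i _ /=.
  by rewrite rmorphM /g addrA addrAC addrK.
have gb : linearly_bounded (- (rw_k P)%:Z + 1) g.
  have [K KP] := rt_sub_C_growth hP; exists K => n.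
  by rewrite /g (addrC (- _)) normc_def /= expr0n /= addr0 sqrtr_sqr lecR KP.
have gb1 : linearly_bounded (- (rw_k P)%:Z + 1) (sdiffs r1 g).
  elim: (r1) (g) gb => [//|z s IHs] f fb.
  exact/IHs/linearly_bounded_sdiff.
have g1 := linearly_bounded_sdiffs_eq0 r2gt gb1 g0.
have [Q sQ gQ] := exppoly_of_sdiffs lam_neq0 r1lam g1.
exists Q => [j|x xk]; first by rewrite -cr1.
by rewrite -gQ// -rmorphD addrC subrK.
Qed.

End ansatz.

(** * The closed form of the runtime and the uniqueness of its coefficients *)

Theorem theorem29 (R : realType) (P : rw_program R) (hP : positively_ast P)
    (c : nat) (lam : 'I_c -> R[i]) (v : 'I_c -> nat)
    (lam_inj : injective lam)
    (lam_roots : forall z : R[i],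
       root (rw_charpoly P) z <-> exists j : 'I_c, z = lam j)
    (v_mult : forall j : 'I_c, v j = mup (lam j) (rw_charpoly P)) :
  [/\ (forall x : int, x <= 0 -> expected_runtime P x = 0%E),
      (exists a : 'I_c -> nat -> R[i],
        let solves (b : 'I_c -> nat -> R[i]) : Prop :=
          forall x : int, - (rw_k P)%:Z + 1 <= x <= 0 ->
            0 = rw_ansatz P lam v b x in
        [/\ solves a,
            (forall b : 'I_c -> nat -> R[i], solves b ->
               forall (j : 'I_c) (u : nat), `|lam j| <= 1 -> (u < v j)%N ->
                 b j u = a j u) &
            (forall x : int, 0 < x ->
               exists2 r : R, expected_runtime P x = r%:E &
                              r%:C = rw_ansatz P lam v a x)]) &
      (rw_k P = 0%N -> forall x : int, 0 < x ->
         expected_runtime P x = (1 / rw_p' P)%:E)].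
Proof.
split; first by move=> x x0; rewrite (expected_runtime_rt hP) (rt_le0 hP).
- have [Q sQ QE] := rt_exppoly hP lam_roots v_mult.
  exists (fun j u => (Q j)`_u) => solves.
  have aE x : rw_ansatz P lam v (fun j u => (Q j)`_u) x =
      (rw_C P x)%:C + exppoly lam Q x.
    by rewrite rw_ansatzE coef_poly_familyK.
  (* For [- k < x <= 0] the runtime is 0, so the closed form read there is the linear system. *)
  have solQ : solves (fun j u => (Q j)`_u).
    by move=> x /andP[xk x0]; rewrite aE -QE// (rt_le0 hP).
  split => // [b solb j u lj uv|x x0]; last first.
    by exists (rt P x); [exact: expected_runtime_rt|rewrite aE QE//; lia].
  (* Uniqueness: two solutions of the system differ by an exponential polynomial that vanishes for
     [- k < x <= 0]. *)
  have := @killed_exppoly_eq0 _ _ _ lam v hP lam_inj lam_roots v_mult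
    (fun j => coef_poly_family lam v b j - Q j).
  move=> Q0; have {Q0} : coef_poly_family lam v b j - Q j = 0; last first.
  - move=> /eqP; rewrite subr_eq0 => /eqP <-.
    by rewrite /coef_poly_family lj coef_poly uv.
  apply: Q0 => [i|x xk].
  - rewrite (leq_trans (size_polyD _ _))// size_polyN geq_max sQ andbT.
    by rewrite /coef_poly_family; case: ifP => _; rewrite ?size_poly ?size_poly0.
  - rewrite exppolyB.
    have := solb x xk; rewrite [LHS](solQ x xk) aE rw_ansatzE.
    by move=> /addrI ->; rewrite subrr.
- by move=> k0 x x0; rewrite (expected_runtime_rt hP) (rt_k0 hP).
Qed.
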